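(* Let $0<\alpha\le\frac{\pi}{3}$, let $R^{\alpha}$ be a rhombus with side length $1$ and with an interior angle $\alpha$, let $\triangle$ be an equilateral triangle with a side parallel to a side (the base) of $R^{\alpha}$, and let $\{\triangle_n\}$ be a collection of homothetic copies of $\triangle$. If $$\sum A(\triangle_n)\ \ge\ \frac{\sqrt3}{4}\Big(1+\cos\alpha+\frac{\sqrt3}{3}\sin\alpha\Big)^2,$$ then $\{\triangle_n\}$ permits a parallel covering of $R^{\alpha}$. Moreover, $$\varrho(R^{\alpha},\triangle)=\frac{\sqrt3\,(\sqrt3+\sqrt3\cos\alpha+\sin\alpha)^2}{12\sin\alpha}.$$
   Context: $A(P)$ denotes the area of a planar convex body $P$. A collection $\{\triangle_n\}$ ($n=1,2,\ldots$) may be finite or infinite. Admissible rigid motions are translations and rotations of the plane (and their compositions). A collection $\{C_n\}$ of convex polygons permits a covering of a convex polygon $P$ if there exist admissible rigid motions $\sigma_n$, one for each $n$, such that $P\subseteq\bigcup_n\sigma_nC_n$. The covering is called parallel if there exists a side of $P$ (called a base of $P$) such that each $\sigma_nC_n$ has a side parallel to it. $\varrho(R^{\alpha},\triangle)$ is the smallest positive number such that any collection of homothetic copies of $\triangle$ with total area not less than $\varrho(R^{\alpha},\triangle)\cdot A(R^{\alpha})$ permits a parallel covering of $R^{\alpha}$. *)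

(* Defs.v *)
From HB Require Import structures.
From mathcomp Require Import all_boot all_order all_algebra.
From mathcomp Require Import all_classical all_reals all_analysis.

Set Implicit Arguments.
Unset Strict Implicit.
Unset Printing Implicit Defensive.

Import Order.TTheory GRing.Theory Num.Theory.
Import numFieldNormedType.Exports.

Local Open Scope classical_set_scope.
Local Open Scope ring_scope.

(* The library norm on a product type is the sup norm, so the Euclidean
   structure of the plane is introduced explicitly below. *)
Notation plane R := (R * R)%type.

Section Plane.
Variable R : realType.
Implicit Types (u v w x y a b c d p : plane R) (P T A : set (plane R)).

Definition dot u v : R := u.1 * v.1 + u.2 * v.2.

Definition enorm u : R := Num.sqrt (dot u u).

Definition angle u v : R := acos (dot u v / (enorm u * enorm v)).

Definition parallel u v : Prop := u.1 * v.2 - u.2 * v.1 = 0.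

Definition area A : \bar R :=
  ((@lebesgue_measure R) \x (@lebesgue_measure R))%E A.

Definition conv_hull A : set (plane R) := smallest (@convex_set R (plane R)) A.

(* A side of a convex polygon P is a nondegenerate segment [a, b] that is a
   face of P, i.e. the intersection of P with a supporting line (the set of
   points of P at which some nonzero linear form attains its maximum on P). *)
Definition side P a b : Prop :=
  a != b /\
  exists2 w, w != 0 &
    [set x | P x /\ forall y, P y -> dot w y <= dot w x]
    = conv_hull [set a; b].

Definition rhombus (s alpha : R) P : Prop :=
  exists p u v,
    [/\ enorm u = s, enorm v = s, angle u v = alpha &
        P = conv_hull [set x | [\/ x = p, x = p + u, x = p + u + v
                                 | x = p + v]]].

Definition equilateral_triangle T : Prop :=
  exists a b c (s : R),
    [/\ 0 < s, enorm (b - a) = s, enorm (c - b) = s, enorm (a - c) = s &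
        T = conv_hull [set x | [\/ x = a, x = b | x = c]]].

Definition homothetic_copy T A : Prop :=
  exists2 k : R, k != 0 &
    exists v, A = (fun x => (k *: x + v : plane R)) @` T.

Definition rotation (theta : R) (x : plane R) : plane R :=
  (cos theta * x.1 - sin theta * x.2, sin theta * x.1 + cos theta * x.2).

(* Compositions of translations and rotations (about arbitrary centres) are
   exactly the maps of this form; reflections are excluded. *)
Definition rigid_motion (f : plane R -> plane R) : Prop :=
  exists theta v, forall x, f x = rotation theta x + v.

(* A finite or infinite collection is a family C indexed by a set I of natural
   numbers; the values of C outside I are irrelevant. *)
Definition permits_parallel_covering (I : set nat) (C : nat -> set (plane R))
    P : Prop :=
  exists sigma : nat -> plane R -> plane R,
    [/\ forall n, I n -> rigid_motion (sigma n),
        P `<=` \bigcup_(n in I) (sigma n @` C n) &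
        exists a b, side P a b /\
          forall n, I n ->
            exists c d, side (sigma n @` C n) c d /\ parallel (b - a) (d - c)].

Definition covering_factor P T (r : R) : Prop :=
  0 < r /\
  forall (I : set nat) (C : nat -> set (plane R)),
    (forall n, I n -> homothetic_copy T (C n)) ->
    (r%:E * area P <= \esum_(n in I) area (C n))%E ->
    permits_parallel_covering I C P.

(* r is the least covering factor; as a relation, this includes the assertion
   that the minimum is attained. *)
Definition is_varrho P T (r : R) : Prop :=
  covering_factor P T r /\ lbound [set r' | covering_factor P T r'] r.

End Plane.

(* Main.v *)
Require Import Defs.
From HB Require Import structures.
From mathcomp Require Import all_boot all_order all_algebra.
From mathcomp Require Import all_classical all_reals all_analysis.
From mathcomp Require Import finmap lra ring.
Import Order.TTheory GRing.Theory Num.Theory.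
Import numFieldNormedType.Exports.
Local Open Scope classical_set_scope.
Local Open Scope ring_scope.

(* Lower bound: if one triangle with an edge parallel to a side of the rhombus
   contains it, a linear form that is constant along another edge of the triangle
   shows that the two ends of the long diagonal force its side to be at least
   L = 1 + cos alpha + sin alpha / sqrt 3.

   Upper bound: in the oblique coordinates spanned by a side u of the rhombus
   and u turned by 60 degrees, equilateral triangles with a side parallel to u
   become right isosceles triangles, and the rhombus lies in a rectangle M x H
   with M + H = L and H <= M.  A strip of height h is filled from left to right
   by triangles of size at least h, alternately upright and upside down, each
   covering exactly h (a - h/2) of its area.  When the large pieces run out, the
   unfilled part is cut into two strips of half the height, so that a piece
   smaller than H is always used in a strip of more than half its size and covers
   at least three quarters of its area.  Since H <= M, this loss and the overshoot
   at the ends of the strips are outweighed by the surplus of the area of the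
   triangle of side L over that of the rectangle. *)

(** * Filling a strip with right isosceles triangles *)

Section Strips.
Set Implicit Arguments.
Unset Strict Implicit.
Variable R : realType.
Implicit Types (A B : set (R * R)) (l : seq nat) (s : nat -> R).
Implicit Types (h w X Y a : R) (q x : R * R) (t : bool).

(* [t = true] is the half-turned triangle; [q] is the vertex with the right
   angle and [a] the length of the legs. *)
Definition tri t q a : set (R * R) :=
  [set x | if t then [/\ x.1 <= q.1, x.2 <= q.2 & q.1 + q.2 - a <= x.1 + x.2]
           else [/\ q.1 <= x.1, q.2 <= x.2 & x.1 + x.2 <= q.1 + q.2 + a]].

Definition covers s l A : Prop :=
  exists pl : nat -> bool * (R * R),
    forall x, A x -> exists2 i, i \in l & tri (pl i).1 (pl i).2 (s i) x.

Lemma coversS s l A B : A `<=` B -> covers s l B -> covers s l A.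
Proof. by move=> AB [pl plP]; exists pl => x /AB; exact: plP. Qed.

Lemma covers_place s l A t q (i : nat) : uniq l -> i \in l ->
  covers s (rem i l) (A `\` tri t q (s i)) -> covers s l A.
Proof.
move=> ul il [pl plP].
exists (fun j => if j == i then (t, q) else pl j) => x Ax.
have [xt|xt] := pselect (tri t q (s i) x); first by exists i => //; rewrite eqxx.
have [//|j] := plP x; rewrite mem_rem_uniq// !inE => /andP[ji jl] xj.
by exists j => //; rewrite (negbTE ji).
Qed.

Lemma covers_cat s l1 l2 A B : uniq (l1 ++ l2) ->
  covers s l1 A -> covers s l2 B -> covers s (l1 ++ l2) (A `|` B).
Proof.
rewrite cat_uniq => /and3P[_ /hasPn dis _] [p1 P1] [p2 P2].
exists (fun j => if j \in l1 then p1 j else p2 j) => x [/P1|/P2] [i il xi].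
  by exists i; rewrite ?mem_cat il.
by exists i; rewrite ?mem_cat ?il ?orbT// (negbTE (dis _ il)).
Qed.

(* [(X, Y)] is the upper right corner and [w] the length of the top side.  The
   left end is slanted when [t] holds and vertical otherwise; it is left open,
   so that the strip is empty as soon as [w <= 0]. *)
Definition strip t h w X Y : set (R * R) :=
  [set x | [/\ x.1 <= X, x.2 <= Y, Y - h <= x.2 &
    if t then X + Y - w < x.1 + x.2 else X - w < x.1]].

(* The additive constant is the one for which placing a triangle lowers the
   demand by exactly its gain, see [demand_rest]. *)
Definition demand t h w : R := h * w + (if t then 0 else h ^+ 2 / 2).

(* The area of a triangle of size [a >= h] inside a strip of height [h] along
   one of its legs. *)
Definition gain h a : R := h * (a - h / 2).

(* The gain of [a] in a strip of the largest height [h / 2 ^ j <= a], [j <= n];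
   smaller pieces are discarded. *)
Fixpoint weight (n : nat) h a : R :=
  if h <= a then gain h a
  else if n is n'.+1 then weight n' (h / 2) a else 0.

(** * Bounds on the weight of a piece *)

Lemma weight_ge n h a : h <= a -> weight n h a = gain h a.
Proof. by case: n => [|n] /= ->. Qed.

Lemma weight0_lt h a : a < h -> weight 0 h a = 0.
Proof. by rewrite ltNge => /negbTE /= ->. Qed.

Lemma weightS_lt n h a : a < h -> weight n.+1 h a = weight n (h / 2) a.
Proof. by rewrite ltNge => /negbTE /= ->. Qed.

Lemma weight_le n h a : 0 < h -> a < h -> weight n h a <= h ^+ 2 / 2.
Proof.
elim: n h => [|n IHn] h h0 ah; rewrite ?weight0_lt ?weightS_lt//; first by nra.
have [ha|ha] := leP (h / 2) a; first by rewrite weight_ge// /gain; nra.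
by have := IHn (h / 2) _ ha; nra.
Qed.

(** At the height [h'] with [h' <= a < 2 * h'], the difference [gain h' a - 3 / 8 * a ^+ 2] is
    [3 / 8 * (2 * h' - a) * (a - 2 / 3 * h')], hence positive. The full area of the piece is
    [a ^+ 2 / 2] in these coordinates. *)
Lemma weight_gt n h a : 0 < h -> h / 2 ^+ n <= a -> a < 2 * h ->
  3 / 8 * a ^+ 2 < weight n h a.
Proof.
elim: n h => [|n IHn] h h0 ha a2h.
  by rewrite expr0 divr1 in ha; rewrite weight_ge// /gain; nra.
have [ha'|ah] := leP h a; first by rewrite weight_ge// /gain; nra.
rewrite weightS_lt//; apply: IHn; [lra| |lra].
by move: ha; rewrite exprS invfM mulrA.
Qed.

Lemma weight_ge0 n h a : 0 < h -> 0 <= weight n h a.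
Proof.
elim: n h => [|n IHn] h h0; have [ha|ah] := leP h a.
- by rewrite weight_ge// /gain; nra.
- by rewrite weight0_lt.
- by rewrite weight_ge// /gain; nra.
by rewrite weightS_lt//; apply: IHn; lra.
Qed.

Lemma weight_mono n m h a : 0 < h -> (n <= m)%N -> weight n h a <= weight m h a.
Proof.
elim: n m h => [|n IHn] m h h0 nm; have [ha|ah] := leP h a;
  rewrite ?(weight_ge _ ha)//.
  by rewrite weight0_lt// weight_ge0.
by case: m nm => // m nm; rewrite !weightS_lt//; apply: IHn => //; lra.
Qed.

Lemma strip_empty t h w X Y : 0 < h -> w <= 0 -> strip t h w X Y `<=` set0.
Proof. by move=> h0 w0 [x1 x2] /= []; case: t => /=; lra. Qed.

Lemma demand_empty t h w : 0 < h -> demand t h w <= 0 -> w <= 0.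
Proof. by rewrite /demand; case: t; nra. Qed.

Lemma covers_set0 s l A : A `<=` set0 -> covers s l A.
Proof. by move=> A0; exists (fun=> (true, 0)) => x /A0. Qed.

(* The width left by a triangle at the left end; the new left end is of the
   other type. *)
Definition rest t h w a : R := if t then w - a else w + h - a.

Lemma strip_place t h w X Y a : exists q,
  strip t h w X Y `\` tri t q a `<=` strip (~~ t) h (rest t h w a) X Y.
Proof.
rewrite /strip /rest; case: t.
  (* The hypotenuse of a half-turned triangle lies on the slanted left end; its vertical leg becomes
     the new left end. *)
  exists (X - w + a, Y) => -[x1 x2] /= [[? ? ? ?] H]; split => //.
  by rewrite ltNge; apply/negP => ?; apply: H; split; lra.
(* An upright triangle sits in the lower left corner; its hypotenuse becomes the new left end. *)
exists (X - w, Y - h) => -[x1 x2] /= [[? ? ? ?] H]; split => //.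
by rewrite ltNge; apply/negP => ?; apply: H; split; lra.
Qed.

Lemma demand_rest t h w a :
  demand (~~ t) h (rest t h w a) = demand t h w - gain h a.
Proof. by rewrite /demand /rest /gain; case: t => /=; field. Qed.

Lemma sum_rem (f : nat -> R) l i : i \in l ->
  \sum_(j <- rem i l) f j = \sum_(j <- l) f j - f i.
Proof. by move=> il; rewrite [in RHS](big_rem i)//= addrAC subrr add0r. Qed.

(** Dropping last terms as long as the sum still reaches [d] leaves an excess of at most one term;
    the maximum with 0 accounts for the empty prefix when [d] is negative. *)
Lemma seq_split (f : nat -> R) l c d : 0 <= c ->
  (forall i, i \in l -> f i <= c) -> d <= \sum_(i <- l) f i ->
  exists l1 l2, [/\ l = l1 ++ l2, d <= \sum_(i <- l1) f i &
    \sum_(i <- l1) f i <= Num.max 0 (d + c)].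
Proof.
move=> c0; elim/last_ind: l => [|l i IH] fc dl.
  by exists [::], [::]; rewrite big_nil in dl *; rewrite le_max lexx.
have [/IH|dl'] := leP d (\sum_(j <- l) f j).
  case=> [j jl|l1 [l2 [-> d1 d2]]]; first by apply: fc; rewrite mem_rcons inE jl orbT.
  by exists l1, (rcons l2 i); rewrite rcons_cat.
exists (rcons l i), [::]; rewrite cats0; split=> //.
rewrite le_max -cats1 big_cat big_seq1 /=; apply/orP; right.
by apply: lerD; [exact: ltW|apply: fc; rewrite mem_rcons inE eqxx].
Qed.

(** * Covering a strip, by induction on the number of halvings *)

Definition strip_coverable n := forall s l t h w X Y, uniq l -> 0 < h ->
  demand t h w <= \sum_(i <- l) weight n h (s i) -> covers s l (strip t h w X Y).

(* Finishing one of the strips may overshoot its demand, but then by at most the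
   reserve [h ^ 2], which leaves enough for the other strip. *)
Lemma two_strips n : strip_coverable n ->
  forall s l t1 t2 h w1 w2 X Y, uniq l -> 0 < h ->
  (forall i, i \in l -> s i < 2 * h) ->
  - h ^+ 2 <= demand t1 h w1 -> - h ^+ 2 <= demand t2 h w2 ->
  demand t1 h w1 + demand t2 h w2 + h ^+ 2 <= \sum_(i <- l) weight n h (s i) ->
  covers s l (strip t1 h w1 X Y `|` strip t2 h w2 X (Y - h)).
Proof.
move=> Sn s l; have [m] := ubnP (size l).
elim: m l => // m IHm l szl t1 t2 h w1 w2 X Y ul h0 s2h N1 N2 N12.
(* Without a piece of size at least [h], the list is cut in two and [Sn] covers each strip with its
   own part. *)
have [[i [il hi]]|small] := pselect (exists i, i \in l /\ h <= s i); last first.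
  have {}small i : i \in l -> s i < h.
    by move=> il; rewrite ltNge; apply/negP => hi; apply: small; exists i.
  have [|i il|//|l1 [l2 [El d1 d2]]] :=
    @seq_split (fun i => weight n h (s i)) l (h ^+ 2 / 2) (demand t1 h w1) _ _ _.
  - by nra.
  - by rewrite weight_le ?small.
  - by lra.
  have ul' := ul; rewrite El in ul' *; apply: covers_cat => //.
    by apply: Sn => //; move: ul'; rewrite cat_uniq => /and3P[].
  apply: Sn => //; first by move: ul'; rewrite cat_uniq => /and3P[].
  (* If the prefix sum is at most 0, the bound [- h ^+ 2 <= demand t1 h w1] leaves enough for the
     second strip; otherwise the excess is at most [h ^+ 2 / 2]. *)
  move: N12; rewrite El big_cat /=.
  by move: d2; rewrite le_max => /orP[]; nra.
have szr : (size (rem i l) < m)%N.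
  by case: l il szl {ul s2h N12} => // ? ? il; rewrite size_rem.
have ur : uniq (rem i l) by rewrite rem_uniq.
have s2r j : j \in rem i l -> s j < 2 * h by move=> /mem_rem; exact: s2h.
have sumr := sum_rem (fun i => weight n h (s i)) il.
rewrite /= (weight_ge n hi) in sumr.
(* A large piece goes to a strip only if the demand there stays at least [- h ^+ 2], so that the
   induction hypothesis applies. *)
have [G1|G1] := leP (- h ^+ 2) (demand t1 h w1 - gain h (s i)).
  have [q Hq] := strip_place t1 h w1 X Y (s i).
  apply: (@covers_place _ _ _ t1 q i) => //.
  apply: (@coversS _ _ _ (strip (~~ t1) h (rest t1 h w1 (s i)) X Y `|`
                          strip t2 h w2 X (Y - h))).
    by move=> x [[?|?] ?]; [left; apply: Hq|right].
  by apply: IHm => //; rewrite demand_rest// sumr; lra.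
have [G2|G2] := leP (- h ^+ 2) (demand t2 h w2 - gain h (s i)).
  have [q Hq] := strip_place t2 h w2 X (Y - h) (s i).
  apply: (@covers_place _ _ _ t2 q i) => //.
  apply: (@coversS _ _ _ (strip t1 h w1 X Y `|`
                          strip (~~ t2) h (rest t2 h w2 (s i)) X (Y - h))).
    by move=> x [[?|?] ?]; [left|right; apply: Hq].
  by apply: IHm => //; rewrite demand_rest// sumr; lra.
(* Both demands are below [h (s i - 3h/2)], so the two regions left are small
   triangles near the right side, and a single piece swallows them. *)
apply: (@covers_place _ _ _ true (X, Y) i) => //.
apply: covers_set0 => -[x1 x2] [S12]; apply.
have sh := s2h i il.
rewrite /demand /gain in G1 G2.
case: S12; rewrite /strip /tri /=.
  case: t1 N1 N12 G1 => ? ? ? [? ? ? ?]; split; nra.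
case: t2 N2 N12 G2 => ? ? ? [? ? ? ?]; split; nra.
Qed.

(** Pieces of size at least [h] are placed at the left end one by one, each lowering the demand by
    exactly its weight, until only smaller ones remain. *)
Lemma strip_coverable_small n :
  (forall s l t h w X Y, uniq l -> 0 < h -> (forall i, i \in l -> s i < h) ->
    demand t h w <= \sum_(i <- l) weight n h (s i) ->
    covers s l (strip t h w X Y)) ->
  strip_coverable n.
Proof.
move=> small s l; have [m] := ubnP (size l).
elim: m l => // m IHm l szl t h w X Y ul h0 N.
have [[i [il hi]]|none] := pselect (exists i, i \in l /\ h <= s i); last first.
  apply: small => // i il; rewrite ltNge; apply/negP => hi.
  by apply: none; exists i.
have [q Hq] := strip_place t h w X Y (s i).
apply: (@covers_place _ _ _ t q i) => //; apply: (coversS Hq).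
apply: IHm; rewrite ?rem_uniq//.
  by case: l il szl {ul N} => // ? ? il; rewrite size_rem.
by rewrite demand_rest (sum_rem (fun i => weight n h (s i)))// weight_ge// lerB.
Qed.

Lemma strips_coverable n : strip_coverable n.
Proof.
elim: n => [|n IHn]; apply: strip_coverable_small => s l t h w X Y ul h0 small N.
  (* With no halving left, pieces below [h] weigh 0, so the demand is not positive and the strip is
     empty. *)
  apply/covers_set0/strip_empty => //; apply: (@demand_empty t h) => //.
  by rewrite big1_seq// in N => i /andP[_ il]; rewrite weight0_lt// small.
have [w0|w0] := leP w 0; first by apply/covers_set0/strip_empty.
(* Going down by [h / 2] along a slanted left end shortens the top side by [h / 2]. *)
pose w2 := if t then w - h / 2 else w.
apply: (@coversS _ _ _ (strip t (h / 2) w X Y `|` strip t (h / 2) w2 X (Y - h / 2))).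
  rewrite /w2 /strip => -[x1 x2] /= [? ? ? H].
  have [?|?] := leP (Y - h / 2) x2; [left|right]; split => //; try lra.
  by move: H; case: (t) => *; lra.
have half i : i \in l -> s i < 2 * (h / 2) by move=> /small; lra.
apply: (two_strips IHn) => //; first by lra.
- by rewrite /demand; case: (t); nra.
- by rewrite /demand /w2; case: (t); nra.
rewrite [X in _ <= X](_ : _ = \sum_(i <- l) weight n.+1 h (s i)); last first.
  by apply: eq_big_seq => i il; rewrite weightS_lt// small.
(* The demands of the halves and the reserve [(h / 2) ^+ 2] add up to exactly [demand t h w]. *)
by apply: le_trans N; rewrite /demand /w2; case: (t); nra.
Qed.

End Strips.

(** * Infinite families *)

Section Rectangle.
Set Implicit Arguments.
Unset Strict Implicit.
Variable R : realType.
Implicit Types (M H L a c : R).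

Lemma half_pow_le H a : 0 < H -> 0 < a -> exists n : nat, H / 2 ^+ n <= a.
Proof.
move=> H0 a0; pose n := (Num.truncn (H / a)).+1; exists n.
have Hn : H / a < n%:R by exact: truncnS_gt.
rewrite ler_pdivrMr ?exprn_gt0// mulrC -ler_pdivrMr//.
apply/ltW/(lt_le_trans Hn).
by rewrite -natrX ler_nat ltnW// ltn_expl.
Qed.

Lemma half_pow_le_seq H (s : nat -> R) (l : seq nat) : 0 < H ->
  (forall i, i \in l -> 0 < s i) ->
  exists n : nat, forall i, i \in l -> H / 2 ^+ n <= s i.
Proof.
move=> H0; elim: l => [|i l IHl] s0; first by exists 0%N.
have [|n nP] := IHl; first by move=> j jl; apply: s0; rewrite inE jl orbT.
have [|k kP] := @half_pow_le H (s i) H0; first by apply: s0; rewrite inE eqxx.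
have mono p q : (p <= q)%N -> H / 2 ^+ q <= H / 2 ^+ p.
  move=> pq; rewrite ler_pM2l// lef_pV2 ?posrE ?exprn_gt0//.
  by rewrite ler_eXn2l// ltr1n.
exists (maxn n k) => j; rewrite inE => /predU1P[->|/nP].
  by apply: le_trans kP; apply: mono; rewrite leq_maxr.
by apply: le_trans; apply: mono; rewrite leq_maxl.
Qed.

(* With [L = M + H], the ratio is the demand of the [M x H] rectangle over the
   squared side of the triangle containing it. *)
Lemma weight_gt_ratio H L n a :
  0 < H -> 2 * H <= L -> H / 2 ^+ n <= a -> a < L ->
  H * (L - H / 2) / L ^+ 2 * a ^+ 2 < weight n H a.
Proof.
move=> H0 HL Hna aL; have L0 : 0 < L by lra.
have an0 : 0 < a by apply: lt_le_trans Hna; rewrite divr_gt0 ?exprn_gt0.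
rewrite mulrAC ltr_pdivrMr ?exprn_gt0//.
have [Ha|aH] := leP H a.
  rewrite weight_ge// /gain.
  (* Twice the difference of the two sides factors in this way. *)
  suff : 0 < H * (L - a) * (L * (a - H) + a * (L - H)) by nra.
  by rewrite !mulr_gt0//; nra.
have W : 3 / 8 * a ^+ 2 < weight n H a by apply: weight_gt => //; lra.
apply: le_lt_trans (_ : 3 / 8 * a ^+ 2 * L ^+ 2 < _); last first.
  by rewrite ltr_pM2r ?exprn_gt0.
(* [(L - 2 * H) * (3 * L - 2 * H)] is eight times [3 / 8 * L ^+ 2 - H * (L - H / 2)], so
   [2 * H <= L] keeps the ratio at most 3/8. *)
suff : 0 <= a ^+ 2 * ((L - 2 * H) * (3 * L - 2 * H)) by nra.
by rewrite mulr_ge0 ?sqr_ge0// mulr_ge0; lra.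
Qed.

Lemma esum_gt_seq (I : set nat) (f : nat -> R) (x : R) :
  (x%:E < \esum_(i in I) (f i)%:E)%E ->
  exists l : seq nat, [/\ uniq l, {in l, forall i, I i} & x < \sum_(i <- l) f i].
Proof.
move=> /ereal_sup_gt[_ [A [finA AI] <-]].
rewrite fsbig_finite// sumEFin lte_fin => xA; exists (enum_fset (fset_set A)); split=> //.
  exact: fset_uniq.
by move=> i; rewrite in_fset_set// => /set_mem/AI.
Qed.

(** A piece of size at least [M + H] covers the rectangle alone. Otherwise [weight_gt_ratio] turns
    the bound on the areas into the demand of a strip with vertical left end that contains the
    rectangle. *)
Lemma rectangle_cover M H c (I : set nat) (s : nat -> R) :
  0 < c -> 0 < H -> H <= M -> (forall i, I i -> 0 < s i) ->
  ((c * (M + H) ^+ 2)%:E <= \esum_(i in I) (c * s i ^+ 2)%:E)%E ->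
  exists pl : nat -> bool * (R * R), forall x : R * R,
    0 <= x.1 <= M -> 0 <= x.2 <= H ->
    exists2 i, I i & tri (pl i).1 (pl i).2 (s i) x.
Proof.
move=> c0 H0 HM s0 Ssum; pose L := M + H.
have L0 : 0 < L by rewrite /L; lra.
have [[i [Ii Li]]|small] := pselect (exists i, I i /\ L <= s i).
  exists (fun=> (false, 0)) => -[x1 x2] /= /andP[? ?] /andP[? ?].
  by exists i => //; rewrite /tri /=; split; rewrite ?add0r//; move: Li; rewrite /L; lra.
have {}small i : I i -> s i < L.
  by move=> Ii; rewrite ltNge; apply/negP => ?; apply: small; exists i.
pose kappa := H * (L - H / 2) / L ^+ 2.
have k0 : 0 < kappa by rewrite divr_gt0 ?exprn_gt0// mulr_gt0//; rewrite /L; lra.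
have kL : kappa * L ^+ 2 = H * (L - H / 2).
  by rewrite /kappa divfK// expf_neq0// gt_eqF.
have kW n a : H / 2 ^+ n <= a -> a < L -> kappa * a ^+ 2 < weight n H a.
  by apply: weight_gt_ratio; rewrite /L; lra.
clearbody kappa.
have [i0 Ii0] : exists i, I i.
  apply/set0P/negP => /eqP I0; move: Ssum.
  by rewrite I0 esum_set0 lee_fin leNgt mulr_gt0// exprn_gt0.
have [n0 n0P] := @half_pow_le H (s i0) H0 (s0 _ Ii0).
(* The strict gain [delta] on a single piece lets a finite subfamily suffice and
   leaves room to widen the half-open strip beyond [M]. *)
pose delta := weight n0 H (s i0) - kappa * s i0 ^+ 2.
have d0 : 0 < delta by rewrite subr_gt0; apply: kW => //; exact: small.
have [|l' [ul' l'I Sl']] := @esum_gt_seq I (fun i => c * s i ^+ 2)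
    (c * (L ^+ 2 - delta / kappa)).
  by apply: lt_le_trans Ssum; rewrite lte_fin ltr_pM2l// ltrBlDr ltrDl divr_gt0.
rewrite -mulr_sumr ltr_pM2l// in Sl'.
(* The piece [i0] is added to the finite subfamily so that its gain [delta] counts. *)
have [l [ul lI i0l Sl]] : exists l : seq nat, [/\ uniq l, {in l, forall i, I i},
    i0 \in l & L ^+ 2 - delta / kappa < \sum_(i <- l) s i ^+ 2].
  have [i0l|i0l] := boolP (i0 \in l'); first by exists l'.
  exists (i0 :: l'); split; rewrite ?inE ?eqxx//= ?i0l//.
    by move=> i /[!inE] /predU1P[->//|]; apply: l'I.
  by rewrite big_cons; apply: lt_le_trans Sl' _; rewrite lerDr sqr_ge0.
have [n1 n1P] : exists n : nat, forall i, i \in l -> H / 2 ^+ n <= s i.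
  by apply: half_pow_le_seq => // i il; exact/s0/lI.
pose n := maxn n0 n1.
have Wge i : i \in l -> kappa * s i ^+ 2 <= weight n H (s i).
  move=> il; apply: (@le_trans _ _ (weight n1 H (s i))).
    by apply/ltW/kW; [exact: n1P|exact/small/lI].
  by rewrite weight_mono// leq_maxr.
(* [kappa * L ^+ 2] is the demand of the rectangle; the finite subfamily falls short of it by less
   than [delta], which [i0] makes up. *)
have Wsum : H * M + H ^+ 2 / 2 < \sum_(i <- l) weight n H (s i).
  rewrite (_ : _ + _ = kappa * (L ^+ 2 - delta / kappa) + delta); last first.
    have kd : kappa * (delta / kappa) = delta by rewrite mulrC divfK ?gt_eqF.
    by rewrite mulrBr kd kL /L; field.
  apply: (@lt_le_trans _ _ (kappa * (\sum_(i <- l) s i ^+ 2) + delta)).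
    by rewrite ltrD2r ltr_pM2l.
  rewrite (big_rem i0)//= [leRHS](big_rem i0)//= mulrDr addrAC lerD//.
    by rewrite /delta addrC subrK weight_mono// leq_maxl.
  rewrite mulr_sumr big_seq [leRHS]big_seq ler_sum// => i /mem_rem; exact: Wge.
(* The width whose demand equals the total weight; as it exceeds [M], the open left end lies outside
   the rectangle. *)
pose w := (\sum_(i <- l) weight n H (s i) - H ^+ 2 / 2) / H.
have wM : M < w by rewrite ltr_pdivlMr// mulrC ltrBrDr.
have [|pl plP] := @strips_coverable R n s l false H w M H ul H0.
  by rewrite /demand /w mulrC divfK ?gt_eqF// subrK.
exists pl => -[x1 x2] /= /andP[? ?] /andP[? ?].
have [|i il] := plP (x1, x2); first by split => /=; lra.
by exists i => //; exact: lI.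
Qed.

End Rectangle.

(** * Convex hulls *)

Section Hulls.
Set Implicit Arguments.
Unset Strict Implicit.
Variable R : realType.
Implicit Types (p q u v w d e x y : plane R) (A : set (plane R)).

Definition comb p u v (s : R * R) : plane R := p + s.1 *: u + s.2 *: v.

Definition std_triangle : set (plane R) :=
  [set s | [/\ 0 <= s.1, 0 <= s.2 & s.1 + s.2 <= 1]].

Definition std_square : set (plane R) :=
  [set s | 0 <= s.1 <= 1 /\ 0 <= s.2 <= 1].

Definition triangle q d e : set (plane R) := comb q d e @` std_triangle.

Definition parallelogram p u v : set (plane R) := comb p u v @` std_square.

Lemma convex_comb A x y (t : R) : @convex_set R (plane R) A ->
  A x -> A y -> 0 <= t -> t <= 1 -> A (t *: x + (1 - t) *: y).
Proof.
move=> cA Ax Ay t0 t1.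
by have /set_mem := cA x y (Itv01 t0 t1) (mem_set Ax) (mem_set Ay).
Qed.

Lemma comb_conv p u v (s s' : R * R) (t : R) :
  t *: comb p u v s + (1 - t) *: comb p u v s' =
  comb p u v (t * s.1 + (1 - t) * s'.1, t * s.2 + (1 - t) * s'.2).
Proof.
case: p u v s s' => [p1 p2] [u1 u2] [v1 v2] [s1 s2] [s1' s2'].
by rewrite /comb; congr (_, _) => /=; rewrite /GRing.scale /=; ring.
Qed.

Lemma comb_ge0 (a b t : R) : 0 <= a -> 0 <= b -> 0 <= t -> t <= 1 ->
  0 <= t * a + (1 - t) * b.
Proof. by move=> *; rewrite addr_ge0// mulr_ge0// subr_ge0. Qed.

Lemma comb_le1 (a b t : R) : a <= 1 -> b <= 1 -> 0 <= t -> t <= 1 ->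
  t * a + (1 - t) * b <= 1.
Proof.
move=> a1 b1 t0 t1; have := @comb_ge0 (1 - a) (1 - b) t.
by rewrite !subr_ge0 => /(_ a1 b1 t0 t1); lra.
Qed.

Lemma convex_set_intro A :
  (forall x y (t : R), A x -> A y -> 0 <= t -> t <= 1 ->
     A (t *: x + (1 - t) *: y)) -> @convex_set R (plane R) A.
Proof.
by move=> cA x y t /set_mem Ax /set_mem Ay; apply/mem_set; apply: cA.
Qed.

Lemma image_comb_convex p u v A :
  (forall s s' t, A s -> A s' -> 0 <= t -> t <= 1 ->
     A (t * s.1 + (1 - t) * s'.1, t * s.2 + (1 - t) * s'.2)) ->
  @convex_set R (plane R) (comb p u v @` A).
Proof.
move=> cA; apply: convex_set_intro => _ _ t [s As <-] [s' As' <-] t0 t1.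
by rewrite comb_conv; apply: imageP; exact: cA.
Qed.

Lemma conv_hull_triangle q d e :
  conv_hull [set x | [\/ x = q, x = q + d | x = q + e]] = triangle q d e.
Proof.
apply/seteqP; split.
  apply: smallest_sub.
    apply: image_comb_convex => -[a b] [a' b'] t /= [? ? ?] [? ? ?] t0 t1.
    split => /=; [exact: comb_ge0|exact: comb_ge0|].
    rewrite addrACA -!mulrDr; exact: comb_le1.
  move=> _ [->|->|->]; [exists (0, 0)|exists (1, 0)|exists (0, 1)];
    rewrite /comb /= ?scale1r ?scale0r ?addr0//; split => /=; lra.
move=> _ [[a b] [/= a0 b0 ab1] <-] M [cM sM].
have Mq : M q by apply: sM; constructor 1.
have Md : M (q + d) by apply: sM; constructor 2.
have Me : M (q + e) by apply: sM; constructor 3.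
have [ab0|ab0] := eqVneq (a + b) 0.
  have [-> ->] : a = 0 /\ b = 0 by split; lra.
  by rewrite /comb /= !scale0r !addr0.
have abp : 0 < a + b by rewrite lt_neqAle eq_sym ab0 addr_ge0.
(* The ray from [q] through the given point meets the opposite edge here. *)
have MM : M (a / (a + b) *: (q + d) + (1 - a / (a + b)) *: (q + e)).
  by apply: convex_comb; rewrite ?divr_ge0 ?ler_pdivrMr ?mul1r ?lerDl// ltW.
have -> : comb q d e (a, b) = (a + b) *: (a / (a + b) *: (q + d)
    + (1 - a / (a + b)) *: (q + e)) + (1 - (a + b)) *: q.
  case: q d e {Mq Md Me MM sM} => [? ?] [? ?] [? ?].
  by rewrite /comb; congr (_, _) => /=; rewrite /GRing.scale /=; field.
by apply: convex_comb => //; exact: ltW.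
Qed.

Lemma conv_hull_parallelogram p u v :
  conv_hull [set x | [\/ x = p, x = p + u, x = p + u + v | x = p + v]] =
  parallelogram p u v.
Proof.
apply/seteqP; split.
  apply: smallest_sub.
    apply: image_comb_convex => -[a b] [a' b'] t /= [/andP[? ?] /andP[? ?]]
      [/andP[? ?] /andP[? ?]] t0 t1.
    by split => /=; rewrite comb_ge0 ?comb_le1.
  move=> _ [->|->|->|->]; [exists (0, 0)|exists (1, 0)|exists (1, 1)|exists (0, 1)];
    rewrite /comb /= ?scale1r ?scale0r ?addr0//; split => /=; lra.
move=> _ [[a b] [/= /andP[a0 a1] /andP[b0 b1]] <-] M [cM sM].
have M1 : M p by apply: sM; constructor 1.
have M2 : M (p + u) by apply: sM; constructor 2.
have M3 : M (p + u + v) by apply: sM; constructor 3.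
have M4 : M (p + v) by apply: sM; constructor 4.
have -> : comb p u v (a, b) = b *: (a *: (p + u + v) + (1 - a) *: (p + v))
    + (1 - b) *: (a *: (p + u) + (1 - a) *: p).
  case: p u v {M1 M2 M3 M4 sM} => [? ?] [? ?] [? ?].
  by rewrite /comb; congr (_, _) => /=; rewrite /GRing.scale /=; ring.
by do 3!apply: convex_comb => //.
Qed.

Lemma conv_hull_segment x y :
  conv_hull [set x; y] = [set z | exists2 t : R, 0 <= t <= 1 & z = x + t *: (y - x)].
Proof.
apply/seteqP; split.
  apply: smallest_sub.
    apply: convex_set_intro => _ _ t [a /andP[a0 a1] ->] [b /andP[b0 b1] ->] t0 t1.
    exists (t * a + (1 - t) * b); first by rewrite comb_ge0 ?comb_le1.
    case: x y => [? ?] [? ?].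
    by congr (_, _) => /=; rewrite /GRing.scale /=; ring.
  move=> _ [->|->]; [exists 0|exists 1]; rewrite ?lexx ?ler01//.
    by rewrite scale0r addr0.
  by rewrite scale1r addrC subrK.
move=> _ [t /andP[t0 t1] ->] M [cM sM].
have -> : x + t *: (y - x) = t *: y + (1 - t) *: x.
  by case: x y {sM} => [? ?] [? ?]; congr (_, _) => /=; rewrite /GRing.scale /=; ring.
by apply: convex_comb => //; apply: sM; [right|left].
Qed.

End Hulls.

(** * Area *)

Section Area.
Set Implicit Arguments.
Unset Strict Implicit.
Variable R : realType.
Local Notation RR := (measurableTypeR R).
Local Notation leb := (@lebesgue_measure R).
Implicit Types (A : set (plane R)) (k b c e : R).

Lemma measurable_affine k b :
  measurable_fun [set: RR] (fun y : RR => k * y + b : RR).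
Proof.
by apply: measurable_realfun.measurable_funD.
Qed.

(** The pushforward scaled by [|k|] has the right value on every half-open interval, and this
    determines Lebesgue measure. *)
Lemma lebesgue_affine k b (A : set RR) : k != 0 -> measurable A ->
  leb A = (`|k|%:E * leb ((fun y => (k * y + b)%R) @^-1` A))%E.
Proof.
move=> k0 mA; pose f : RR -> RR := fun y => k * y + b.
pose mu := mscale (NngNum (normr_ge0 k))
  (measure_function_pushforward__canonical__measure_function_Measure leb
    (measurable_affine k b)).
apply: (@lebesgue_measure_unique R mu) => // _ [[c d] _ <-] /=.
rewrite -[RHS]/(`|k|%:E * leb (f @^-1` `]c, d]))%E.
have [k_lt0|k_gt0|k_eq0] := ltgtP k 0; last by rewrite k_eq0 eqxx in k0.
  rewrite (_ : f @^-1` _ = `[(d - b) / k, (c - b) / k[%classic); last first.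
    apply/seteqP; split=> y; rewrite /f /= !in_itv/= ler_ndivrMr// ltr_ndivlMr//;
      by move=> /andP[? ?]; apply/andP; split; lra.
  rewrite !lebesgue_measure_itv/= !lte_fin ltr_ndivlMr// divfK ?lt_eqF//.
  rewrite ltrD2r; case: ifPn => _; last by rewrite mule0.
  by rewrite ltr0_norm// -!EFinB -EFinM; congr EFin; field.
rewrite (_ : f @^-1` _ = `](c - b) / k, (d - b) / k]%classic); last first.
  apply/seteqP; split=> y; rewrite /f /= !in_itv/= ler_pdivlMr// ltr_pdivrMr//;
    by move=> /andP[? ?]; apply/andP; split; lra.
rewrite !lebesgue_measure_itv/= !lte_fin ltr_pdivrMr// divfK ?gt_eqF//.
rewrite ltrD2r; case: ifPn => _; last by rewrite mule0.
by rewrite gtr0_norm// -!EFinB -EFinM; congr EFin; field.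
Qed.

Lemma measurable_affine2 a b c : measurable_fun [set: (RR * RR)%type]
  (fun x : RR * RR => a * x.1 + b * x.2 + c : RR).
Proof.
apply: measurable_realfun.measurable_funD => //.
by apply: measurable_realfun.measurable_funD => //; exact: measurable_realfun.measurable_funM.
Qed.

(* Fubini: on each vertical line a shear is an affine map of the line. *)
Lemma area_vshear k c e A : k != 0 -> @measurable _ (RR * RR)%type A ->
  area A = (`|k|%:E * area ((fun x => (x.1, c * x.1 + k * x.2 + e)%R) @^-1` A))%E.
Proof.
move=> k0 mA; rewrite /area /product_measure1 -ge0_integralZl//; last first.
  apply: measurable_fun_xsection.
  rewrite -[X in measurable X]setTI; apply: measurable_fun_pair => //.
  exact: measurable_affine2.
apply: eq_integral => x _ /=.
rewrite (lebesgue_affine (c * x + e) k0); last exact: measurable_xsection.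
congr (_ * leb _)%E; rewrite !xsectionE.
by apply/seteqP; split => y /=; rewrite (_ : c * x + k * y + e = k * y + (c * x + e))//; ring.
Qed.

Lemma area_swap A : @measurable _ (RR * RR)%type A ->
  area A = area ((fun x => (x.2, x.1)) @^-1` A).
Proof.
move=> mA.
have msw : measurable_fun [set: (RR * RR)%type] (fun x : RR * RR => (x.2, x.1)).
  by apply: measurable_fun_pair.
pose mu := measure_function_pushforward__canonical__measure_function_Measure
  (leb \x leb)%E msw.
apply: (@product_measure_unique _ _ _ _ _ leb leb mu) => // X Y mX mY.
rewrite /mu /= /pushforward (_ : _ @^-1` _ = Y `*` X); last first.
  by apply/seteqP; split => -[x y] [].
by rewrite product_measure1E// muleC.
Qed.

Lemma measurable_affine_map a b c d e1 e2 : measurable_fun [set: (RR * RR)%type]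
  (fun x : RR * RR => (a * x.1 + b * x.2 + e1, c * x.1 + d * x.2 + e2) : RR * RR).
Proof. by apply: measurable_fun_pair; exact: measurable_affine2. Qed.

Lemma measurable_preimage (f : RR * RR -> RR * RR) A :
  measurable_fun [set: (RR * RR)%type] f -> @measurable _ (RR * RR)%type A ->
  @measurable _ (RR * RR)%type (f @^-1` A).
Proof. by move=> mf mA; rewrite -[X in measurable X]setTI; exact: mf. Qed.

Lemma measurable_swap :
  measurable_fun [set: (RR * RR)%type] (fun x : RR * RR => (x.2, x.1)).
Proof. by apply: measurable_fun_pair. Qed.

Lemma area_hshear k c e A : k != 0 -> @measurable _ (RR * RR)%type A ->
  area A = (`|k|%:E * area ((fun x => (k * x.1 + c * x.2 + e, x.2)%R) @^-1` A))%E.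
Proof.
move=> k0 mA; have mB := measurable_preimage measurable_swap mA.
rewrite (area_swap mA) (area_vshear c e k0 mB); congr (_ * _)%E.
rewrite [RHS]area_swap; last first.
  apply: measurable_preimage => //.
  by apply: measurable_fun_pair => //; exact: measurable_affine2.
by congr area; apply/seteqP; split => -[x y] /=; rewrite [c * x + _]addrC.
Qed.

(** For [d != 0] the map is a vertical shear followed by a horizontal one of factor
    [(a * d - b * c) / d]. For [d = 0], exchanging the coordinates of the target puts [b] in the
    place of [d]. *)
Lemma area_affine a b c d e1 e2 A : a * d - b * c != 0 ->
  @measurable _ (RR * RR)%type A ->
  area A = (`|a * d - b * c|%:E * area
    ((fun x => (a * x.1 + b * x.2 + e1, c * x.1 + d * x.2 + e2)%R) @^-1` A))%E.
Proof.
have main a' b' c' d' e1' e2' A' : d' != 0 -> a' * d' - b' * c' != 0 ->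
  @measurable _ (RR * RR)%type A' ->
  area A' = (`|a' * d' - b' * c'|%:E * area
    ((fun x => (a' * x.1 + b' * x.2 + e1', c' * x.1 + d' * x.2 + e2')%R) @^-1` A'))%E.
  move=> d0 det0 mA; pose k := (a' * d' - b' * c') / d'.
  have k0 : k != 0 by rewrite mulf_neq0 ?invr_eq0.
  pose e := e1' - b' / d' * e2'.
  rewrite (area_hshear (b' / d') e k0 mA) (area_vshear c' e2' d0); last first.
    apply: measurable_preimage mA; apply: measurable_fun_pair => //; exact: measurable_affine2.
  rewrite muleA -EFinM -normrM /k divfK//; congr (_ * area _)%E.
  apply/funext => x /=.
  by congr (A' (_, _)); rewrite /k /e; field.
move=> det0 mA; have [d0|d0] := eqVneq d 0; last exact: main.
have b0 : b != 0 by apply: contraNneq det0 => ->; rewrite d0 mulr0 mul0r subr0.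
have mB := measurable_preimage measurable_swap mA.
have det0' : c * b - d * a != 0 by rewrite -oppr_eq0 opprB mulrC [c * b]mulrC.
rewrite (area_swap mA) (main c d a b e2 e1 _ b0 det0' mB).
by rewrite distrC mulrC [c * b]mulrC.
Qed.

Lemma measurable_halfplane a b c :
  @measurable _ (RR * RR)%type [set x | a * x.1 + b * x.2 + c <= 0].
Proof.
rewrite -[X in measurable X]setTI.
have /(_ measurableT `]-oo, 0]%classic) := measurable_affine2 a b c.
rewrite (_ : _ @^-1` _ = [set x | a * x.1 + b * x.2 + c <= 0]).
  by apply; exact: measurable_itv.
by apply/seteqP; split => x /=; rewrite in_itv.
Qed.

Lemma measurable_std_triangle : @measurable _ (RR * RR)%type (@std_triangle R).
Proof.
rewrite (_ : @std_triangle R = [set x | - 1 * x.1 + 0 * x.2 + 0 <= 0] `&`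
  [set x | 0 * x.1 + - 1 * x.2 + 0 <= 0] `&`
  [set x | 1 * x.1 + 1 * x.2 + - 1 <= 0]).
  by do 2?[apply: measurableI]; exact: measurable_halfplane.
apply/seteqP; split => x /= => [[*]|[[*]]]; first by (do 2?split) => /=; lra.
by split; lra.
Qed.

Lemma std_squareE : @std_square R = `[0, 1]%classic `*` `[0, 1]%classic.
Proof. by apply/seteqP; split => x [] /=; rewrite !in_itv. Qed.

Lemma measurable_std_square : @measurable _ (RR * RR)%type (@std_square R).
Proof. by rewrite std_squareE; apply: measurableX; exact: measurable_itv. Qed.

Lemma area_std_square : area (@std_square R) = 1%:E.
Proof.
rewrite std_squareE /area product_measure1E//=.
by rewrite lebesgue_measure_itv/= lte_fin ltr01 oppr0 adde0 mule1.
Qed.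

Lemma area_antidiagonal : area [set x : plane R | x.1 + x.2 = 1] = 0%:E.
Proof.
rewrite /area /product_measure1 integral0_eq// => x _ /=.
rewrite (_ : xsection _ x = [set 1 - x]) ?lebesgue_measure_set1//.
by rewrite xsectionE; apply/seteqP; split => y /=; lra.
Qed.

(** The half-turn about the centre of the unit square maps the triangle to the other half of the
    square, and the two overlap in the null set [D]. *)
Lemma area_std_triangle : area (@std_triangle R) = (2^-1)%:E.
Proof.
pose D : set (plane R) := [set x | x.1 + x.2 = 1].
have mT := measurable_std_triangle.
have mD : @measurable _ (RR * RR)%type D.
  rewrite (_ : D = [set x | 1 * x.1 + 1 * x.2 + - 1 <= 0] `&`
      [set x | - 1 * x.1 + - 1 * x.2 + 1 <= 0]).
    by apply: measurableI; exact: measurable_halfplane.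
  by apply/seteqP; split => x; rewrite /D /= => *; [split|]; lra.
have det0 : - 1 * - 1 - 0 * 0 != 0 :> R by rewrite mulrNN !mulr1 mulr0 subr0 oner_neq0.
have := area_affine 1 1 det0 mT.
set T' := _ @^-1` _ => ET.
have mT' : @measurable _ (RR * RR)%type T'.
  by apply: measurable_preimage mT; exact: measurable_affine_map.
have {}ET : area (@std_triangle R) = area T'.
  by rewrite ET mulrNN !mulr1 mulr0 subr0 normr1 mul1e.
have TD : area (@std_triangle R) = area (@std_triangle R `\` D).
  rewrite [LHS](measureDI (leb \x leb)%E mT mD) [X in (_ + X)%E](_ : _ = 0%:E) ?adde0//.
  apply: (@subset_measure0 _ _ _ (leb \x leb)%E _ D) => //; first exact: measurableI.
  exact: area_antidiagonal.
have sq : area (@std_square R) = (area (@std_triangle R `\` D) + area T')%E.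
  rewrite (_ : @std_square R = (@std_triangle R `\` D) `|` T').
    rewrite /area measureU//; first exact: measurableD.
    by apply/seteqP; split => x //= [[[? ? ?] xD] [/= ? ? ?]]; apply: xD; rewrite /D /=; lra.
  apply/seteqP; split => x /=.
    move=> [/andP[? ?] /andP[? ?]].
    have [?|?] := ltP (x.1 + x.2) 1; [left|right].
      by split; [split; lra|rewrite /D /=; lra].
    by split => /=; lra.
  by move=> [[[? ? ?] _]|[/= ? ? ?]]; split; lra.
move: sq; rewrite area_std_square -TD -ET.
case: (area _) => [r| |] //=; rewrite -?EFinD => -[] r1.
by congr EFin; lra.
Qed.

Definition cross (u v : plane R) : R := u.1 * v.2 - u.2 * v.1.

Lemma area_comb (p u v : plane R) A : cross u v != 0 ->
  @measurable _ (RR * RR)%type A ->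
  area (comb p u v @` A) = (`|cross u v|%:E * area A)%E.
Proof.
move=> uv0 mA.
have combE x : comb p u v x =
    (u.1 * x.1 + v.1 * x.2 + p.1, u.2 * x.1 + v.2 * x.2 + p.2).
  by case: p u v uv0 x => [? ?] [? ?] [? ?] ? [? ?]; congr (_, _) => /=;
    rewrite /GRing.scale /=; ring.
(* The inverse by Cramer's rule; it turns the image of [A] into a preimage, hence a measurable
   set. *)
pose g (y : plane R) : plane R :=
  (v.2 / cross u v * y.1 + - v.1 / cross u v * y.2
     + (v.1 * p.2 - v.2 * p.1) / cross u v,
   - u.2 / cross u v * y.1 + u.1 / cross u v * y.2
     + (u.2 * p.1 - u.1 * p.2) / cross u v).
have combK : cancel (comb p u v) g.
  move=> x; rewrite combE [RHS]surjective_pairing /g /=.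
  by congr (_, _); move: uv0; rewrite /cross => uv0; field.
have gK : cancel g (comb p u v).
  move=> x; rewrite combE [RHS]surjective_pairing /g /=.
  by congr (_, _); move: uv0; rewrite /cross => uv0; field.
have mB : @measurable _ (RR * RR)%type (comb p u v @` A).
  rewrite (_ : _ @` _ = g @^-1` A).
    by apply: measurable_preimage mA; exact: measurable_affine_map.
  apply/seteqP; split=> [_ [x Ax <-]|y Ay] /=; first by rewrite combK.
  by exists (g y).
have det0 : u.1 * v.2 - v.1 * u.2 != 0 by rewrite [v.1 * _]mulrC.
rewrite (area_affine p.1 p.2 det0 mB) [v.1 * _]mulrC; congr (_ * area _)%E.
apply/seteqP; split=> x /=; rewrite -combE; last by exists x.
by move=> [y Ay /(can_inj combK) <-].
Qed.

End Area.

(** * Triangles, rhombi and their sides *)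

Section Geometry.
Set Implicit Arguments.
Unset Strict Implicit.
Variable R : realType.
Implicit Types (p q u v w d e x y z : plane R) (A S P : set (plane R)).
Implicit Types (k s t theta alpha : R).
Local Notation r3 := (Num.sqrt (3 : R)).

Lemma sqr_r3 : r3 * r3 = 3.
Proof. by rewrite -expr2 sqr_sqrtr. Qed.

Lemma r3_gt0 : 0 < r3. Proof. by rewrite sqrtr_gt0. Qed.

Definition rot60 d : plane R := (d.1 / 2 - r3 / 2 * d.2, r3 / 2 * d.1 + d.2 / 2).

(** A vertex and one directed edge, the third vertex lying counterclockwise. Rigid motions and
    homotheties act on [q] and [d] alone, and a half-turn changes the sign of [d]. *)
Definition equi q d : set (plane R) := triangle q d (rot60 d).

Lemma cross_rot60 d : cross d (rot60 d) = r3 / 2 * dot d d.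
Proof. by rewrite /cross /dot /=; field. Qed.

Lemma dotxx_gt0 d : d != 0 -> 0 < dot d d.
Proof.
move=> d0; rewrite lt_neqAle /dot addr_ge0 -?expr2 ?sqr_ge0// andbT eq_sym.
rewrite paddr_eq0 ?sqr_ge0// !sqrf_eq0; apply: contraNN d0 => /andP[/eqP a /eqP b].
by apply/eqP; rewrite [LHS]surjective_pairing a b.
Qed.

Lemma cross_orthogonal w x y : w != 0 -> dot w x = 0 -> dot w y = 0 -> cross x y = 0.
Proof.
move=> /dotxx_gt0; rewrite lt0r => /andP[w0 _] wx wy.
apply: (mulfI w0); rewrite mulr0.
transitivity (dot w x * cross w y - cross w x * dot w y); last by rewrite wx wy; ring.
by rewrite /dot /cross; ring.
Qed.

Lemma cross_trans x y z : y != 0 -> cross x y = 0 -> cross y z = 0 -> cross x z = 0.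
Proof.
move=> /dotxx_gt0; rewrite lt0r => /andP[y0 _] xy yz.
apply: (mulfI y0); rewrite mulr0.
transitivity (cross x y * dot y z + cross y z * dot x y); last by rewrite xy yz; ring.
by rewrite /dot /cross; ring.
Qed.

Lemma scale_of_cross0 u d : dot u u = 1 -> cross u d = 0 -> d = dot u d *: u.
Proof.
move=> uu ud; rewrite [LHS]surjective_pairing [RHS]surjective_pairing /=.
have E1 : d.1 * dot u u = dot u d * u.1 - cross u d * u.2 by rewrite /dot /cross; ring.
have E2 : d.2 * dot u u = dot u d * u.2 + cross u d * u.1 by rewrite /dot /cross; ring.
move: E1 E2; rewrite uu ud !mulr1 !mul0r subr0 addr0 => E1 E2.
by congr (_, _).
Qed.

Lemma image_triangle (f : plane R -> plane R) q d e q' d' e' :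
  (forall a : plane R, f (comb q d e a) = comb q' d' e' a) ->
  f @` triangle q d e = triangle q' d' e'.
Proof.
move=> fE; rewrite /triangle image_comp.
by apply: eq_imagel => a _; exact: fE.
Qed.

Lemma rot60Z k d : rot60 (k *: d) = k *: rot60 d.
Proof. by rewrite /rot60; congr (_, _) => /=; rewrite /GRing.scale /=; ring. Qed.

Lemma rotation_rot60 theta d : rotation theta (rot60 d) = rot60 (rotation theta d).
Proof. by rewrite /rot60 /rotation; congr (_, _) => /=; ring. Qed.

Lemma image_equi_homothety k v q d :
  (fun x => (k *: x + v : plane R)) @` equi q d = equi (k *: q + v) (k *: d).
Proof.
rewrite /equi rot60Z; apply: image_triangle => -[t1 t2].
case: q v d (rot60 d) => [? ?] [? ?] [? ?] [? ?].
by congr (_, _) => /=; rewrite /GRing.scale /=; ring.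
Qed.

Lemma image_equi_motion theta v q d :
  (fun x => rotation theta x + v) @` equi q d =
  equi (rotation theta q + v) (rotation theta d).
Proof.
rewrite /equi -rotation_rot60; apply: image_triangle => -[t1 t2].
case: q v d (rot60 d) => [? ?] [? ?] [? ?] [? ?].
by congr (_, _) => /=; rewrite /GRing.scale /=; ring.
Qed.

Lemma dot_rotation theta d : dot (rotation theta d) (rotation theta d) = dot d d.
Proof.
rewrite /dot /rotation /=; have := cos2Dsin2 theta.
set c := cos theta; set s := sin theta => cs.
by transitivity ((c ^+ 2 + s ^+ 2) * (d.1 * d.1 + d.2 * d.2)); [ring|rewrite cs mul1r].
Qed.

Lemma polar (a b : R) : a ^+ 2 + b ^+ 2 = 1 -> exists theta, cos theta = a /\ sin theta = b.
Proof.
move=> ab; have a1 : -1 <= a <= 1.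
  by rewrite -ler_norml -(@ler_pXn2r _ 2)// ?nnegrE// real_normK ?num_real// expr1n; nra.
have sE : sin (acos a) = `|b|.
  by rewrite sin_acos// -sqrtr_sqr; congr Num.sqrt; lra.
have [b0|b0] := leP 0 b.
  by exists (acos a); rewrite acosK ?in_itv//= sE ger0_norm.
by exists (- acos a); rewrite cosN acosK ?in_itv//= sinN sE ltr0_norm// opprK.
Qed.

Lemma rotation_to d d' : d != 0 -> dot d d = dot d' d' ->
  exists theta, rotation theta d = d'.
Proof.
move=> /dotxx_gt0 d0 dd'.
(* The cosine and the sine of the oriented angle from [d] to [d']. *)
have [|theta [c s]] := @polar (dot d d' / dot d d) (cross d d' / dot d d).
  rewrite !expr_div_n -mulrDl (_ : _ + _ = dot d d * dot d' d'); last first.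
    by rewrite /dot /cross; ring.
  by rewrite -dd' -expr2 divff// expf_neq0 ?gt_eqF.
exists theta; rewrite [RHS]surjective_pairing /rotation c s.
have dn : dot d d != 0 by rewrite gt_eqF.
by congr (_, _); apply: (mulfI dn); move: dn; rewrite /dot /cross => dn; field.
Qed.

Lemma equi_place q d q' d' : d != 0 -> dot d d = dot d' d' ->
  exists2 f, rigid_motion f & f @` equi q d = equi q' d'.
Proof.
move=> d0 /(rotation_to d0)[theta td].
exists (fun x => rotation theta x + (q' - rotation theta q)).
  by exists theta, (q' - rotation theta q).
by rewrite image_equi_motion td addrC subrK.
Qed.

(** Starting from the next vertex permutes the barycentric coordinates cyclically. *)
Lemma triangle_rotate q d e : triangle q d e = triangle (q + d) (e - d) (- d).
Proof.
apply/seteqP; split => _ [[a b] [/= a0 b0 ab] <-].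
  exists (b, 1 - a - b); first by split => /=; lra.
  case: q d e => [? ?] [? ?] [? ?].
  by congr (_, _) => /=; rewrite /GRing.scale /=; ring.
exists (1 - a - b, a); first by split => /=; lra.
case: q d e => [? ?] [? ?] [? ?].
by congr (_, _) => /=; rewrite /GRing.scale /=; ring.
Qed.

Lemma rot60_rot60 d : rot60 (rot60 d) = rot60 d - d.
Proof.
case: d => [a b]; have Ea := congr1 ( *%R^~ a) sqr_r3.
have Eb := congr1 ( *%R^~ b) sqr_r3.
by congr (_, _) => /=; move: Ea Eb => /=; lra.
Qed.

Lemma rot60_rot120 d : rot60 (rot60 d - d) = - d.
Proof.
case: d => [a b]; have Ea := congr1 ( *%R^~ a) sqr_r3.
have Eb := congr1 ( *%R^~ b) sqr_r3.
by congr (_, _) => /=; move: Ea Eb => /=; lra.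
Qed.

Lemma equi_rotate q d : equi q d = equi (q + d) (rot60 d - d).
Proof. by rewrite /equi triangle_rotate rot60_rot120. Qed.

Lemma dot_rot60 d : dot (rot60 d) (rot60 d) = dot d d.
Proof.
by have := congr1 ( *%R^~ (dot d d)) sqr_r3; rewrite /dot /=; lra.
Qed.

Lemma dot_rot120 d : dot (rot60 d - d) (rot60 d - d) = dot d d.
Proof. by rewrite -rot60_rot60 !dot_rot60. Qed.

Lemma enorm_sqr d : enorm d ^+ 2 = dot d d.
Proof. by rewrite sqr_sqrtr// /dot addr_ge0// -expr2 sqr_ge0. Qed.

(** Lagrange's identity gives [cross d e] up to sign, and the sign is the orientation of the
    triangle. *)
Lemma rot60_of_dots d e : dot d d != 0 -> 2 * dot d e = dot d d -> dot e e = dot d d ->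
  e = rot60 d \/ d = rot60 e.
Proof.
move=> d0 de ee.
have : (2 * cross d e - r3 * dot d d) * (2 * cross d e + r3 * dot d d) = 0.
  transitivity (4 * (dot d d * dot e e) - (2 * dot d e) ^+ 2 - (r3 * r3) * dot d d ^+ 2).
    by rewrite /cross /dot; ring.
  by rewrite sqr_r3 ee de; ring.
have key x y (c : R) : dot x x != 0 -> dot x y * 2 = dot x x ->
    2 * cross x y = c * dot x x ->
    y = (x.1 / 2 - c / 2 * x.2, c / 2 * x.1 + x.2 / 2).
  move=> x0 xy cxy; rewrite [LHS]surjective_pairing.
  have E1 : y.1 * dot x x = dot x y * x.1 - cross x y * x.2 by rewrite /dot /cross; ring.
  have E2 : y.2 * dot x x = dot x y * x.2 + cross x y * x.1 by rewrite /dot /cross; ring.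
  have {}xy : dot x y = dot x x / 2 by lra.
  have {}cxy : cross x y = c / 2 * dot x x by lra.
  by congr (_, _); apply: (mulIf x0); rewrite ?E1 ?E2 xy cxy; field.
move=> /eqP; rewrite mulf_eq0 => /orP[/eqP H|/eqP H].
  by left; apply: key; lra.
right; apply: key; rewrite ee//.
  by rewrite -de /dot; ring.
by rewrite (_ : cross e d = - cross d e); [lra|rewrite /cross; ring].
Qed.

Lemma equilateral_equi A : equilateral_triangle A ->
  exists q d, d != 0 /\ A = equi q d.
Proof.
move=> [a [b [c [s [s0 ab bc ca ->]]]]].
pose d := b - a; pose e := c - a.
have dd : dot d d = s ^+ 2 by rewrite -enorm_sqr ab.
have ee : dot e e = s ^+ 2.
  by rewrite -ca enorm_sqr /dot /e /=; ring.
have de : 2 * dot d e = s ^+ 2.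
  have : dot (c - b) (c - b) = s ^+ 2 by rewrite -enorm_sqr bc.
  have -> : dot (c - b) (c - b) = dot d d + dot e e - 2 * dot d e.
    by rewrite /d /e /dot /=; ring.
  by rewrite dd ee; lra.
have s20 : s ^+ 2 != 0 by rewrite expf_neq0 ?gt_eqF.
have dn x : dot x x = s ^+ 2 -> x != 0.
  by move=> E; apply: contraNneq s20 => x0; rewrite -E x0 /dot /= !mul0r addr0.
have := conv_hull_triangle a d e; rewrite /d /e ![a + (_ - a)]addrC !subrK => ->.
have [|||H|H] := @rot60_of_dots d e; rewrite ?dd ?ee//.
  by exists a, d; split; [exact: dn|rewrite /equi -H].
exists a, e; split; [exact: dn|rewrite /equi -H].
have swap x y : triangle a x y `<=` triangle a y x.
  move=> _ [[t1 t2] [/= ? ? ?] <-]; exists (t2, t1); first by split => /=; lra.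
  by rewrite /comb /= addrAC.
by apply/seteqP; split; exact: swap.
Qed.

(** * Sides of triangles and parallelograms, and their directions *)

Lemma dotZ k x : dot (k *: x) (k *: x) = k ^+ 2 * dot x x.
Proof. by rewrite /dot /= /GRing.scale /=; ring. Qed.

Lemma dot_comb w p u v (a : plane R) :
  dot w (comb p u v a) = dot w p + a.1 * dot w u + a.2 * dot w v.
Proof. by rewrite /dot /comb /= /GRing.scale /=; ring. Qed.

Lemma side_comb S p u v : 0 < cross u v ->
  (forall a, S a -> 0 <= a.2 /\ (a.2 = 0 -> 0 <= a.1 <= 1)) ->
  (forall t, 0 <= t <= 1 -> S (t, 0)) ->
  side (comb p u v @` S) p (p + u).
Proof.
move=> uv S0 S1.
have u0 : u != 0 by apply: contraTneq uv => ->; rewrite /cross /= !mul0r subrr ltxx.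
split; first by rewrite eq_sym -subr_eq0 addrC addKr.
(* The outward normal of the edge along [u]; its form drops by [cross u v] per unit of the second
   coordinate. *)
pose w : plane R := (u.2, - u.1); exists w.
  apply: contraNneq u0 => -[u2 /eqP]; rewrite oppr_eq0 => /eqP u1.
  by apply/eqP; rewrite [LHS]surjective_pairing u1 u2.
have wE (a : plane R) : dot w (comb p u v a) = dot w p - a.2 * cross u v.
  by rewrite dot_comb /dot /w /cross /=; ring.
rewrite conv_hull_segment; apply/seteqP; split.
  move=> x /= [[a /S0[a20 a1] <-] xmax].
  have S00 : S (0, 0) by apply: S1; rewrite lexx ler01.
  have := xmax _ (imageP (comb p u v) S00); rewrite !wE mul0r subr0 => a2.
  have a2_eq0 : a.2 = 0 by nra.
  by exists a.1; [exact: a1|rewrite /comb a2_eq0 scale0r addr0 [p + u]addrC addrK].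
move=> x /= [t t01 ->]; have -> : p + t *: (p + u - p) = comb p u v (t, 0).
  by rewrite /comb /= scale0r addr0 [p + u]addrC addrK.
split; first exact/imageP/S1.
by move=> _ [a /S0[a20 _] <-]; rewrite !wE mul0r subr0; nra.
Qed.

Lemma side_triangle q d e : 0 < cross d e -> side (triangle q d e) q (q + d).
Proof.
move=> de; apply: side_comb => //.
  by move=> a /= [a1 a2 a12]; split => // a20; lra.
by move=> t /andP[t0 t1]; split => /=; lra.
Qed.

Lemma side_parallelogram p u v : 0 < cross u v -> side (parallelogram p u v) p (p + u).
Proof.
move=> uv; apply: side_comb => //.
  by move=> a /= [a1 /andP[]].
by move=> t t01; split => //=; rewrite lexx ler01.
Qed.

Lemma side_maximizers A a b : side A a b -> exists2 w, w != 0 &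
  [/\ a != b, A a, A b, forall y, A y -> dot w y <= dot w a &
      forall y, A y -> dot w y <= dot w b].
Proof.
move=> [ab [w w0 E]]; exists w => //.
have : conv_hull [set a; b] a.
  by rewrite conv_hull_segment; exists 0; rewrite ?lexx ?ler01// scale0r addr0.
have : conv_hull [set a; b] b.
  by rewrite conv_hull_segment; exists 1; rewrite ?lexx ?ler01// scale1r addrC subrK.
by rewrite -E => -[? ?] [? ?]; split.
Qed.

Lemma dotB w x y : dot w (x - y) = dot w x - dot w y.
Proof. by rewrite /dot /=; ring. Qed.

(** If the form [w] is constant along neither edge, comparing both ends of the side with the points
    that mix their coordinates shows that the ends coincide. *)
Lemma side_parallelogram_direction p u v a b : side (parallelogram p u v) a b ->
  cross u (b - a) = 0 \/ cross v (b - a) = 0.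
Proof.
move=> /side_maximizers[w w0 [ab Aa Ab wa wb]].
have wab : dot w (b - a) = 0.
  by rewrite dotB; apply/eqP; rewrite subr_eq0 eq_le wa// wb.
have [wu|wu] := eqVneq (dot w u) 0; first by left; exact: cross_orthogonal wu wab.
have [wv|wv] := eqVneq (dot w v) 0; first by right; exact: cross_orthogonal wv wab.
case/eqP: ab; move: Aa Ab wa wb => [[a1 a2] [a1b a2b] <-] [[b1 b2] [b1b b2b] <-] wa wb.
have par c : std_square c -> parallelogram p u v (comb p u v c) by move=> ?; exists c.
have := wa (comb p u v (b1, a2)) (par (b1, a2) (conj b1b a2b)).
have := wa (comb p u v (a1, b2)) (par (a1, b2) (conj a1b b2b)).
have := wb (comb p u v (b1, a2)) (par (b1, a2) (conj b1b a2b)).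
have := wb (comb p u v (a1, b2)) (par (a1, b2) (conj a1b b2b)).
rewrite !dot_comb /= => ? ? ? ?.
have -> : a1 = b1 by apply: (mulIf wu); lra.
by have -> : a2 = b2 by apply: (mulIf wv); lra.
Qed.

(** If [w] is constant along no edge, its values at the three vertices are distinct, so the maximum
    is attained at a single vertex and the side would degenerate. *)
Lemma side_triangle_direction q d e a b : side (triangle q d e) a b ->
  [\/ cross d (b - a) = 0, cross e (b - a) = 0 | cross (e - d) (b - a) = 0].
Proof.
move=> /side_maximizers[w w0 [ab Aa Ab wa wb]].
have wab : dot w (b - a) = 0.
  by rewrite dotB; apply/eqP; rewrite subr_eq0 eq_le wa// wb.
have [wd|wd] := eqVneq (dot w d) 0; first by constructor 1; exact: cross_orthogonal wd wab.
have [we|we] := eqVneq (dot w e) 0; first by constructor 2; exact: cross_orthogonal we wab.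
have [wde|wde] := eqVneq (dot w e) (dot w d).
  by constructor 3; apply: cross_orthogonal wab => //; rewrite dotB wde subrr.
case/eqP: ab; move: Aa Ab wab wa wb => [[a1 a2] Sa <-] [[b1 b2] Sb <-].
have tri c : std_triangle c -> triangle q d e (comb q d e c) by move=> ?; exists c.
have v0 : std_triangle ((0, 0) : plane R) by split => /=; lra.
have v1 : std_triangle ((1, 0) : plane R) by split => /=; lra.
have v2 : std_triangle ((0, 1) : plane R) by split => /=; lra.
rewrite dotB => /eqP; rewrite subr_eq0 => /eqP wab wa _.
move: (wa _ (tri _ v0)) (wa _ (tri _ v1)) (wa _ (tri _ v2)) wab => {wa}.
case: Sa Sb; rewrite !dot_comb /= => ? ? ? [? ? ?].
set m := a1 * dot w d + a2 * dot w e => m0 m1 m2 mb.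
have {}m0 : 0 <= m by rewrite /m; lra.
have {}m1 : 0 <= m - dot w d by rewrite /m; lra.
have {}m2 : 0 <= m - dot w e by rewrite /m; lra.
(* The maximum [m], taken relative to [q], is a weighted mean of the vertex values, so a vertex of
   positive weight must attain it. *)
have bary (c1 c2 : R) : 0 <= c1 -> 0 <= c2 -> c1 + c2 <= 1 ->
    m = c1 * dot w d + c2 * dot w e ->
    [/\ (1 - c1 - c2) * m = 0, c1 * (m - dot w d) = 0 & c2 * (m - dot w e) = 0].
  move=> c10 c20 c12 mE.
  have P0 : 0 <= (1 - c1 - c2) * m by rewrite mulr_ge0//; lra.
  have P1 : 0 <= c1 * (m - dot w d) by rewrite mulr_ge0.
  have P2 : 0 <= c2 * (m - dot w e) by rewrite mulr_ge0.
  by split; move: P0 P1 P2; lra.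
have [//|//|//||E0 E1 E2] := bary a1 a2; first by [].
have [//|//|//||F0 F1 F2] := bary b1 b2; first by rewrite /m; lra.
have cancel (x y z : R) : y != 0 -> x * y = 0 -> x = 0.
  by move=> y0 /eqP; rewrite mulf_eq0 (negbTE y0) orbF => /eqP.
have [mE|mE] := eqVneq m 0.
  rewrite mE !sub0r in E1 E2 F1 F2.
  have -> : a1 = 0 by apply: (mulIf wd); lra.
  have -> : a2 = 0 by apply: (mulIf we); lra.
  have -> : b1 = 0 by apply: (mulIf wd); lra.
  by have -> : b2 = 0 by apply: (mulIf we); lra.
have Ea : a1 + a2 = 1 by apply: (mulIf mE); lra.
have Eb : b1 + b2 = 1 by apply: (mulIf mE); lra.
have wed : dot w e - dot w d != 0 by rewrite subr_eq0.
have a2E : a2 = 1 - a1 by lra.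
have b2E : b2 = 1 - b1 by lra.
have ab1 : a1 = b1 by apply: (mulIf wed); move: mb; rewrite /m a2E b2E; lra.
by rewrite a2E b2E ab1.
Qed.

(** The triple angle formula at [pi / 3] reads [(c + 1) * (2 * c - 1) ^+ 2 = 0], and [c] is
    positive. *)
Lemma cos_pi3 : cos (pi / 3) = 1 / 2 :> R.
Proof.
have pi0 := pi_gt0 R.
set c := cos (pi / 3).
have c0 : 0 < c by apply: cos_gt0_pihalf; lra.
have : cos (pi / 3 + (pi / 3 + pi / 3)) = -1 :> R by rewrite -cospi; congr cos; field.
rewrite cosD cosD sinD -/c => E.
have s2 : sin (pi / 3 : R) * sin (pi / 3) = 1 - c ^+ 2 by rewrite -expr2 sin2cos2.
have {}E : (c + 1) * (2 * c - 1) ^+ 2 = 0.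
  have E2 := congr1 ( *%R^~ c) s2.
  by move: E s2 E2 => /=; set s := sin _; lra.
move/eqP: E; rewrite mulf_eq0 gt_eqF ?addr_gt0//= expf_eq0 /= subr_eq0 => /eqP.
by lra.
Qed.

Lemma angle_bounds alpha : 0 < alpha <= pi / 3 ->
  1 / 2 <= cos alpha :> R /\ 0 < sin alpha.
Proof.
move=> /andP[a0 a3]; have pi0 := pi_gt0 R; split; last by apply: sin_gt0_pi; lra.
rewrite -cos_pi3 -[leLHS]/(cos _) leNgt ltr_cos ?in_itv/= -?leNgt//;
  by apply/andP; split; lra.
Qed.

(** [angle] is unsigned, so [cross u v] is [sin alpha] up to sign; exchanging [u] and [v] makes it
    positive. *)
Lemma rhombus_parallelogram alpha P : 0 < alpha <= pi / 3 -> rhombus 1 alpha P ->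
  exists p u v, [/\ dot u u = 1, dot v v = 1, dot u v = cos alpha,
    cross u v = sin alpha & P = parallelogram p u v].
Proof.
move=> a3 [p [u [v [u1 v1 uv ->]]]]; have [_ s0] := angle_bounds a3.
rewrite conv_hull_parallelogram.
move: uv; rewrite /angle u1 v1 mulr1 divr1 => uv.
have uu : dot u u = 1 by rewrite -enorm_sqr u1 expr1n.
have vv : dot v v = 1 by rewrite -enorm_sqr v1 expr1n.
have lagrange : dot u v ^+ 2 + cross u v ^+ 2 = 1.
  by transitivity (dot u u * dot v v); [rewrite /dot /cross; ring|rewrite uu vv mulr1].
have duv : cos alpha = dot u v.
  rewrite -uv acosK// in_itv/= -ler_norml -(@ler_pXn2r _ 2)// ?nnegrE//.
  by rewrite real_normK ?num_real// expr1n; nra.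
have : (cross u v - sin alpha) * (cross u v + sin alpha) = 0.
  by have := cos2Dsin2 alpha; rewrite duv; nra.
move=> /eqP; rewrite mulf_eq0 subr_eq0 addr_eq0 => /orP[/eqP suv|/eqP suv].
  by exists p, u, v; split.
exists p, v, u; split=> //; first by rewrite duv /dot; ring.
  by rewrite -[RHS]opprK -suv /cross; ring.
have swap x y : parallelogram p x y `<=` parallelogram p y x.
  move=> _ [[t1 t2] [/= ? ?] <-]; exists (t2, t1) => //.
  by rewrite /comb /= addrAC.
by apply/seteqP; split; exact: swap.
Qed.

(** * Lower bound for a single triangle *)

Lemma equi_aligned q d y :
  [\/ cross d y = 0, cross (rot60 d) y = 0 | cross (rot60 d - d) y = 0] ->
  exists q' d', [/\ equi q d = equi q' d', dot d' d' = dot d d & cross d' y = 0].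
Proof.
case=> H; first by exists q, d.
  (* The base vertex is advanced twice, which makes the third edge the first one. *)
  exists (q + d + (rot60 d - d)), (- rot60 d); split.
  - by rewrite equi_rotate [LHS]equi_rotate rot60_rot120 opprB addKr.
  - by rewrite -[RHS]dot_rot60 /dot /=; ring.
  - by move: H; rewrite /cross /=; lra.
by exists (q + d), (rot60 d - d); rewrite -equi_rotate dot_rot120.
Qed.

(** Squares are compared because the directed edge of the triangle is a multiple [k] of unknown sign
    of the unit edge of the rhombus. *)
Lemma sqr_bound k t (L : R) : L = k * t -> -1 <= t <= 1 -> L ^+ 2 <= k ^+ 2.
Proof.
move=> -> /andP[t1 t2]; rewrite exprMn ler_piMr ?sqr_ge0//.
have : 0 <= (1 - t) * (1 + t) by apply: mulr_ge0; lra.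
by rewrite expr2; lra.
Qed.

(** The ends [p] and [p + u + v] of the long diagonal lie in the triangle. A form taking only the
    values 0 and [k] at its vertices, up to a constant, varies by at most [|k|] there, but by [L]
    along the diagonal. The base may be along [u] or along [v]. *)
Lemma equi_covering_rhombus alpha p u v q d a b a' b' :
  dot u u = 1 -> dot v v = 1 -> dot u v = cos alpha -> cross u v = sin alpha ->
  side (parallelogram p u v) a b -> side (equi q d) a' b' -> parallel (b - a) (b' - a') ->
  parallelogram p u v `<=` equi q d ->
  (1 + cos alpha + r3 / 3 * sin alpha) ^+ 2 <= dot d d.
Proof.
move=> uu vv cuv suv sP sT par PT.
have ab : b - a != 0 by case: sP => ab _; rewrite subr_eq0 eq_sym.
have ab' : b' - a' != 0 by case: sT => ab' _; rewrite subr_eq0 eq_sym.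
have [q' [d' [Eq dd' d'y]]] := equi_aligned q (side_triangle_direction sT).
have r30 := r3_gt0; have r3K := sqr_r3.
rewrite -dd'; move: PT; rewrite Eq => PT {Eq dd' sT}.
have [|[t1 t2] [/= t10 t20 t12] pE] := PT p.
  by exists (0, 0); [split => /=; rewrite lexx ler01|rewrite /comb /= !scale0r !addr0].
have [|[c1 c2] [/= c10 c20 c12] pE'] := PT (p + u + v).
  by exists (1, 1); [split => /=; rewrite lexx ler01|rewrite /comb /= !scale1r].
have functional w : dot w u + dot w v =
    (c1 - t1) * dot w d' + (c2 - t2) * dot w (rot60 d').
  have dotD x y : dot w (x + y) = dot w x + dot w y by rewrite /dot /=; ring.
  have := congr1 (dot w) pE'; have := congr1 (dot w) pE.
  by rewrite !dot_comb !dotD /=; lra.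
have flip x y : cross x y = 0 -> cross y x = 0 by rewrite /cross; lra.
have sg (g : plane R) : dot g g = 1 -> cross g (b - a) = 0 -> d' = dot g d' *: g.
  move=> gg gab; apply: scale_of_cross0 gg _.
  by apply: (cross_trans ab' _ (flip _ _ d'y)); exact: cross_trans ab gab par.
have [gab|gab] := side_parallelogram_direction sP.
  have dE := sg u uu gab; move: (dot u d') dE => k dE; rewrite {}dE in functional *.
  rewrite dotZ uu mulr1; apply: (@sqr_bound _ (c1 + c2 - (t1 + t2))); last by lra.
  (* The form [w] is 1 on both [u] and [rot60 u], and [L] on [u + v]. *)
  pose w : plane R := u + r3 / 3 *: (- u.2, u.1).
  have wE x : dot w x = dot u x + r3 / 3 * cross u x.
    by rewrite /w /dot /cross /= /GRing.scale /=; ring.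
  have wu : dot w u = 1 by rewrite wE uu /cross mulrC; lra.
  have wr : dot w (rot60 u) = 1.
    have dr : dot u (rot60 u) = dot u u / 2 by rewrite /dot /=; field.
    by rewrite wE cross_rot60 dr uu; lra.
  have wZ x : dot w (k *: x) = k * dot w x by rewrite /dot /= /GRing.scale /=; ring.
  have := functional w; rewrite rot60Z !wZ wr wu wE cuv suv; lra.
have dE := sg v vv gab; move: (dot v d') dE => k dE; rewrite {}dE in functional *.
rewrite dotZ vv mulr1; apply: (@sqr_bound _ (c1 - t1)); last by lra.
(* Here [w] is 1 on [v] and 0 on [rot60 v], and again [L] on [u + v]. *)
pose w : plane R := (2 * r3 / 3) *: ((rot60 v).2, - (rot60 v).1).
have wE x : dot w x = 2 * r3 / 3 * cross x (rot60 v).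
  by rewrite /w /dot /cross /= /GRing.scale /=; ring.
have wv : dot w v = 1 by rewrite wE cross_rot60 vv; lra.
have wr : dot w (rot60 v) = 0 by rewrite wE /cross; ring.
have wu : dot w u = cos alpha + r3 / 3 * sin alpha.
  rewrite wE (_ : cross u (rot60 v) = cross u v / 2 + r3 / 2 * dot u v); last first.
    by rewrite /cross /dot /=; field.
  have := congr1 ( *%R^~ (cos alpha)) r3K; rewrite /= cuv suv; lra.
have wZ x : dot w (k *: x) = k * dot w x by rewrite /dot /= /GRing.scale /=; ring.
by have := functional w; rewrite rot60Z !wZ wr wu wv; lra.
Qed.

(** * Upper bound: areas, coordinates and the covering of the rhombus *)

Lemma area_equi q d : d != 0 -> area (equi q d) = (r3 / 4 * dot d d)%:E.
Proof.
move=> /dotxx_gt0 d0; have r30 := r3_gt0.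
have c0 : 0 < cross d (rot60 d) by rewrite cross_rot60 !mulr_gt0// invr_gt0.
rewrite area_comb ?gt_eqF//; last exact: measurable_std_triangle.
by rewrite area_std_triangle gtr0_norm// -EFinM cross_rot60; congr EFin; field.
Qed.

Lemma area_parallelogram p u v : 0 < cross u v ->
  area (parallelogram p u v) = (cross u v)%:E.
Proof.
move=> uv; rewrite area_comb ?gt_eqF//; last exact: measurable_std_square.
by rewrite area_std_square gtr0_norm// mule1.
Qed.

Lemma homothetic_copy_equi q d A : d != 0 -> homothetic_copy (equi q d) A ->
  exists q' d', d' != 0 /\ A = equi q' d'.
Proof.
move=> d0 [k k0 [v ->]]; exists (k *: q + v), (k *: d).
by rewrite image_equi_homothety scaler_eq0 negb_or k0.
Qed.

Lemma side_equi q d : d != 0 -> side (equi q d) q (q + d).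
Proof.
move=> /dotxx_gt0 d0; apply: side_triangle.
by rewrite cross_rot60 mulr_gt0// divr_gt0// r3_gt0.
Qed.

(** On the axes [u] and [rot60 u], a right isosceles triangle becomes an equilateral one; the
    half-turned kind has its edges along [- u] and [- rot60 u]. *)
Lemma tri_equi b p u (q : R * R) s (a : plane R) : 0 < s ->
  tri b q s a ->
  equi (comb p u (rot60 u) q) ((if b then - s else s) *: u)
    (comb p u (rot60 u) a).
Proof.
move=> s0 H; set k := if b then _ else _.
have k0 : k != 0 by rewrite /k; case: (b); rewrite ?oppr_eq0 gt_eqF.
exists ((a.1 - q.1) / k, (a.2 - q.2) / k).
  move: H; rewrite /tri /k; case: b {k k0} => -[? ? ?]; split => /=.
  - by rewrite invrN mulrN -mulNr opprB; apply: divr_ge0; rewrite ?subr_ge0// ltW.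
  - by rewrite invrN mulrN -mulNr opprB; apply: divr_ge0; rewrite ?subr_ge0// ltW.
  - by rewrite -mulrDl invrN mulrN -mulNr ler_pdivrMr//; lra.
  - by apply: divr_ge0; rewrite ?subr_ge0// ltW.
  - by apply: divr_ge0; rewrite ?subr_ge0// ltW.
  - by rewrite -mulrDl ler_pdivrMr//; lra.
rewrite rot60Z; case: p u (rot60 u) a q {H} => [? ?] [? ?] [? ?] [? ?] [? ?].
by congr (_, _) => /=; rewrite /GRing.scale /=; field.
Qed.

(** [v] is [cos alpha] times [u] plus [sin alpha] times the normal of [u], and that normal is
    [(2 * rot60 u - u) / sqrt 3]. *)
Lemma rhombus_coordinates alpha p u v (a : plane R) :
  dot u u = 1 -> dot u v = cos alpha -> cross u v = sin alpha ->
  comb p u v a = comb p u (rot60 u)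
    (a.1 + a.2 * (cos alpha - r3 / 3 * sin alpha), a.2 * (2 * r3 / 3 * sin alpha)).
Proof.
move=> uu <- <-.
have vE1 : v.1 = dot u v * u.1 - cross u v * u.2.
  by rewrite -[LHS]mulr1 -uu /dot /cross; ring.
have vE2 : v.2 = dot u v * u.2 + cross u v * u.1.
  by rewrite -[LHS]mulr1 -uu /dot /cross; ring.
have r3K := sqr_r3.
move: (dot u v) (cross u v) vE1 vE2 => c s.
case: p u v {uu} a => [p1 p2] [u1 u2] [v1 v2] [a1 a2] /= -> ->.
have E1 := congr1 ( *%R^~ (a2 * s * u1)) r3K.
have E2 := congr1 ( *%R^~ (a2 * s * u2)) r3K.
by congr (_, _); rewrite /rot60 /= /GRing.scale /=; move: E1 E2 => /=; lra.
Qed.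

Lemma equis_cover_rhombus alpha p u v (I : set nat) (C : nat -> set (plane R)) :
  0 < alpha <= pi / 3 -> dot u u = 1 -> dot u v = cos alpha -> cross u v = sin alpha ->
  (forall n, I n -> exists q d, d != 0 /\ C n = equi q d) ->
  ((r3 / 4 * (1 + cos alpha + r3 / 3 * sin alpha) ^+ 2)%:E
     <= \esum_(n in I) area (C n))%E ->
  permits_parallel_covering I C (parallelogram p u v).
Proof.
move=> a3 uu cuv suv Cequi areaC; have [cos2 sin0] := angle_bounds a3.
have r30 := r3_gt0; have r3K := sqr_r3.
have /choice[qd qdP] : forall n, exists qd : plane R * plane R, I n ->
    qd.2 != 0 /\ C n = equi qd.1 qd.2.
  move=> n; have [In|nIn] := pselect (I n); last by exists (0, 0).
  by have [q [d H]] := Cequi n In; exists (q, d).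
pose s n := enorm (qd n).2.
have s0 n : I n -> 0 < s n.
  by move=> /qdP[/dotxx_gt0 d0 _]; rewrite sqrtr_gt0.
pose M := 1 + (cos alpha - r3 / 3 * sin alpha); pose H := 2 * r3 / 3 * sin alpha.
have sc := cos2Dsin2 alpha.
(* This is [H <= M] in another form, and it rests on [cos alpha >= 1 / 2], that is, on the bound for
   the angle. *)
have r3s : r3 * sin alpha <= 1 + cos alpha.
  have r3s0 : 0 <= r3 * sin alpha by rewrite mulr_ge0// ltW.
  have c10 : 0 <= 1 + cos alpha by lra.
  rewrite -(@ler_pXn2r _ 2)// ?nnegrE//.
  rewrite exprMn [r3 ^+ 2]expr2 r3K.
  have : 0 <= (2 * cos alpha - 1) * (1 + cos alpha) by apply: mulr_ge0; lra.
  by lra.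
(* Hence the rhombus does not extend to the left of the rectangle. *)
have shift0 : 0 <= cos alpha - r3 / 3 * sin alpha by lra.
have H0 : 0 < H by rewrite !mulr_gt0.
have c0 : 0 < r3 / 4 by rewrite divr_gt0.
have HM : H <= M by rewrite /H /M; lra.
have [|pl plP] := @rectangle_cover R M H (r3 / 4) I s c0 H0 HM s0.
  rewrite (_ : M + H = 1 + cos alpha + r3 / 3 * sin alpha); last by rewrite /M /H; field.
  apply: le_trans areaC _; rewrite le_eqVlt; apply/orP; left; apply/eqP.
  by apply: eq_esum => n /qdP[d0 ->]; rewrite area_equi// enorm_sqr.
(* The directed edges of the placed triangles, all along the base [u], reversed for half-turned
   pieces. *)
pose D n := (if (pl n).1 then - s n else s n) *: u.
pose Q n := comb p u (rot60 u) (pl n).2.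
have D0 n : I n -> D n != 0.
  move=> /s0 sn; have u0 : u != 0.
    apply/eqP => u0; move: uu; rewrite u0 /dot /= !mul0r addr0 => /esym/eqP.
    by rewrite oner_eq0.
  by rewrite /D scaler_eq0 negb_or u0 andbT; case: ifP; rewrite ?oppr_eq0 gt_eqF.
have /choice[sigma sigmaP] : forall n, exists f, I n ->
    rigid_motion f /\ f @` C n = equi (Q n) (D n).
  move=> n; have [In|nIn] := pselect (I n); last by exists id.
  have [d0 CE] := qdP n In.
  have [|f fm fE] := @equi_place (qd n).1 (qd n).2 (Q n) (D n) d0.
    by rewrite /D dotZ uu mulr1; case: ifP; rewrite ?sqrrN enorm_sqr.
  by exists f; rewrite CE.
exists sigma; split.
- by move=> n /sigmaP[].
- move=> _ [a [/andP[a10 a11] /andP[a20 a21]] <-].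
  rewrite (rhombus_coordinates p a uu cuv suv).
  set b := (_, _); have [||n In bn] := plP b.
  + rewrite /b /M /=; apply/andP; split; first by rewrite addr_ge0// mulr_ge0.
    by rewrite lerD// ler_piMl.
  + rewrite /b /= -/H; apply/andP; split; first by rewrite mulr_ge0// ltW.
    by rewrite ler_piMl// ltW.
  exists n => //; have [_ ->] := sigmaP n In.
  exact: tri_equi (s0 n In) bn.
exists p, (p + u); split; first by apply: side_parallelogram; rewrite suv.
move=> n In; exists (Q n), (Q n + D n); have [_ ->] := sigmaP n In.
split; first exact/side_equi/D0.
by rewrite ![_ + _ - _]addrC !addKr /parallel /D /= /GRing.scale /=; ring.
Qed.

End Geometry.

Theorem theorem3p1 (R : realType) (alpha : R) (Ralpha T : set (plane R))
    (halpha : 0 < alpha <= pi / 3)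
    (hR : rhombus 1 alpha Ralpha)
    (hT : equilateral_triangle T)
    (hbase : exists a b c d : plane R,
        [/\ side Ralpha a b, side T c d & parallel (b - a) (d - c)]) :
  (forall (I : set nat) (C : nat -> set (plane R)),
      (forall n, I n -> homothetic_copy T (C n)) ->
      ((Num.sqrt 3 / 4 *
          (1 + cos alpha + Num.sqrt 3 / 3 * sin alpha) ^+ 2)%:E
        <= \esum_(n in I) area (C n))%E ->
      permits_parallel_covering I C Ralpha) /\
  is_varrho Ralpha T
    (Num.sqrt 3 * (Num.sqrt 3 + Num.sqrt 3 * cos alpha + sin alpha) ^+ 2
      / (12 * sin alpha)).
Proof.
have [p [u [v [uu vv cuv suv RE]]]] := rhombus_parallelogram halpha hR.
have [q [d [d0 TE]]] := equilateral_equi hT.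
have [cos2 sin0] := angle_bounds halpha.
have r30 := r3_gt0 R; have r3K := sqr_r3 R.
set L := 1 + cos alpha + _ * sin alpha.
have L0 : 0 < L by rewrite /L; have := mulr_gt0 r30 sin0; lra.
set r := _ / (12 * sin alpha).
(* The claimed factor times the area of the rhombus is the area of the triangle of side [L]. *)
have rL : r * sin alpha = Num.sqrt 3 / 4 * L ^+ 2.
  rewrite /r (_ : Num.sqrt 3 + Num.sqrt 3 * cos alpha + sin alpha = Num.sqrt 3 * L).
    rewrite exprMn expr2 r3K; field; exact: lt0r_neq0.
  by rewrite /L; have := congr1 ( *%R^~ (sin alpha)) r3K; move=> /=; lra.
have r0 : 0 < r by rewrite -(pmulr_lgt0 _ sin0) rL mulr_gt0 ?exprn_gt0// divr_gt0.
have areaR : area Ralpha = (sin alpha)%:E by rewrite RE area_parallelogram suv.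
have cover (I : set nat) (C : nat -> set (plane R)) :
    (forall n, I n -> homothetic_copy T (C n)) ->
    ((Num.sqrt 3 / 4 * L ^+ 2)%:E <= \esum_(n in I) area (C n))%E ->
    permits_parallel_covering I C Ralpha.
  move=> hC areaC; rewrite RE; apply: equis_cover_rhombus areaC => // n In.
  by apply: (homothetic_copy_equi (q := q) d0); rewrite -TE; exact: hC.
split; first exact: cover.
split.
  split=> // I C hC; rewrite areaR -EFinM rL; exact: cover.
move=> r' [r'0 r'cov].
(* The squared side of the equilateral triangle whose area is [r'] times that of the rhombus; the
   collection consisting of this one triangle is tested. *)
pose c := r' * sin alpha * 4 / Num.sqrt 3.
have c0 : 0 < c by rewrite divr_gt0 ?mulr_gt0.
have dd := dotxx_gt0 d0.
pose k := Num.sqrt (c / dot d d).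
have k0 : k != 0 by rewrite gt_eqF// sqrtr_gt0 divr_gt0.
have kd : dot (k *: d) (k *: d) = c.
  by rewrite dotZ sqr_sqrtr ?divfK ?gt_eqF// ltW// divr_gt0.
have hC n : [set 0%N] n -> homothetic_copy T (equi (k *: q + 0) (k *: d)).
  by move=> _; exists k => //; exists 0; rewrite TE image_equi_homothety.
have kd0 : k *: d != 0 by rewrite scaler_eq0 negb_or k0.
have [|sigma [sm cov [a [b [sR sT]]]]] := r'cov _ (fun=> equi (k *: q + 0) (k *: d)) hC.
  rewrite esum_set1 ?area_equi// ?lee_fin ?kd; last by rewrite !mulr_ge0 ?divr_ge0 ?ltW.
  rewrite areaR -EFinM lee_fin /c le_eqVlt; apply/orP; left; apply/eqP.
  by field; exact: lt0r_neq0.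
have [theta [w sE]] := sm 0%N erefl.
have imE : sigma 0%N @` equi (k *: q + 0) (k *: d) =
    equi (rotation theta (k *: q + 0) + w) (rotation theta (k *: d)).
  by rewrite -image_equi_motion; apply: eq_imagel => x _; exact: sE.
have [a' [b' []]] := sT 0%N erefl; rewrite imE => sT' par.
rewrite RE in sR cov.
(* This single triangle has to contain the rhombus, so its side is at least [L]. *)
have Lc : L ^+ 2 <= c.
  rewrite -kd -(dot_rotation theta).
  apply: (equi_covering_rhombus uu vv cuv suv sR sT' par).
  by move=> x /cov[n ->]; rewrite imE.
rewrite -(ler_pM2r sin0) rL.
apply: (@le_trans _ _ (Num.sqrt 3 / 4 * c)); first by rewrite ler_pM2l ?divr_gt0.
by rewrite /c le_eqVlt; apply/orP; left; apply/eqP; field; exact: lt0r_neq0.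
Qed.
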